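(* Let $(X,r)$ be a finite non-degenerate, involutive set-theoretic solution of the quantum Yang-Baxter equation and let $x\in X$. The following are equivalent: 1. $(X,r)$ is an indecomposable solution of a finite multipermutation level. 2. There is a finite left brace $A$ with $X\subseteq A$ such that $A$ is generated as a left brace by the single element $x$, $X=\{x+a\cdot x : a\in A\}$, $r$ is the restriction to $X\times X$ of the Yang-Baxter map associated to $A$, and moreover $A^{(m)}=0$ for some $m$.
   Context: A set-theoretic solution of the quantum Yang-Baxter equation (QYBE) is a pair $(X,r)$ with $X$ a non-empty set and $r:X\times X\to X\times X$ a bijection, written $r(x,y)=(\sigma_x(y),\tau_y(x))$, satisfying $r_1r_2r_1=r_2r_1r_2$ on $X^3$, where $r_1=r\times \mathrm{id}_X$, $r_2=\mathrm{id}_X\times r$. It is non-degenerate if all $\sigma_x,\tau_x$ are permutations of $X$, and involutive if $r^2=\mathrm{id}$. A non-degenerate solution $(X,r)$ is decomposable if there are non-empty disjoint subsets $X_1,X_2\subseteq X$ with $X=X_1\cup X_2$ and $r(X_i\times X_j)=X_j\times X_i$ for all $i,j\in\{1,2\}$; otherwise it is indecomposable. For a non-degenerate involutive solution, the retract relation on $X$ is $x\sim y$ iff $\sigma_x=\sigma_y$; the induced solution $\mathrm{Ret}(X,r)=(X/\!\sim,r^{\sim})$, $r^\sim([x],[y])=([\sigma_x(y)],[\tau_y(x)])$, is the retraction of $(X,r)$. $(X,r)$ has (finite) multipermutation level $m$ if $m$ is the smallest nonnegative integer such that after $m$ retractions one obtains a solution with one element. A left brace is an abelian group $(A,+)$ with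 a multiplication $\cdot$ such that $a\cdot(b+c)=a\cdot b+a\cdot c$ and the operation $a\circ b=a\cdot b+a+b$ makes $A$ a group. $A$ is generated by $x$ if $A$ is the smallest left brace (under the operations of $A$) containing $x$. The Yang-Baxter map associated to $A$ is $r':A\times A\to A\times A$, $r'(x,y)=(x\cdot y+y,\ z\cdot x+x)$, where $z$ is the unique element with $z\cdot(x\cdot y+y)+z+x\cdot y+y=0$. Set $A^{(1)}=A$ and $A^{(i+1)}=A^{(i)}\cdot A$, where for $C,D\subseteq A$, $C\cdot D$ is the set of finite sums of elements $c\cdot d$ with $c\in C$, $d\in D$. *)

(* Defs.v *)
From HB Require Import structures.
From mathcomp Require Import all_boot all_algebra generic_quotient.
Set Implicit Arguments.
Unset Strict Implicit.
Unset Printing Implicit Defensive.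
Import GRing.Theory.
Local Open Scope ring_scope.
Local Open Scope quotient_scope.

Section Solutions.
Variables (X : finType) (r : X * X -> X * X).

(* r (x, y) = (sigma x y, tau y x) *)
Definition sigma (x y : X) : X := (r (x, y)).1.
Definition tau (y x : X) : X := (r (x, y)).2.

Definition map12 (t : X * X * X) : X * X * X := (r t.1, t.2).
Definition map23 (t : X * X * X) : X * X * X :=
  let p := r (t.1.2, t.2) in (t.1.1, p.1, p.2).

Definition ybe_solution : Prop :=
  bijective r /\
  forall t, map12 (map23 (map12 t)) = map23 (map12 (map23 t)).

Definition nondegenerate_solution : Prop :=
  (forall x, bijective (sigma x)) /\ (forall y, bijective (tau y)).

(* X_1, X_2 are D true, D false. *)
Definition decomposable : Prop :=
  exists D : bool -> {set X},
    [/\ forall i, D i != set0,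
        [disjoint D true & D false],
        D true :|: D false = setT
      & forall i j, r @: setX (D i) (D j) = setX (D j) (D i)].

Definition indecomposable : Prop := ~ decomposable.

Definition retract_rel : rel X :=
  fun x y => [forall z, sigma x z == sigma y z].

Lemma retract_relP x y : reflect (sigma x =1 sigma y) (retract_rel x y).
Proof. by apply: (iffP forallP) => h z; apply/eqP. Qed.

Lemma retract_rel_equiv : equiv_class_of retract_rel.
Proof.
split=> [x | x y | y x z].
- exact/retract_relP.
- by apply/retract_relP/retract_relP => h z; rewrite h.
- by move=> /retract_relP h1 /retract_relP h2; apply/retract_relP => t;
     rewrite h1 h2.
Qed.

Canonical retract_equiv := EquivRelPack retract_rel_equiv.

Definition retract_type := {eq_quot retract_rel}.
HB.instance Definition _ := Choice.on retract_type.
HB.instance Definition _ := EqQuotient.on retract_type.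
HB.instance Definition _ : isCountable retract_type :=
  CanIsCountable (@reprK _ retract_type).
HB.instance Definition _ : isFinite retract_type :=
  CanIsFinite (@reprK _ retract_type).

Definition retract_pi (x : X) : retract_type := \pi x.

(* Defined through representatives; independence of their choice is
   [retract_mapE] below. *)
Definition retract_map (p : retract_type * retract_type) :
    retract_type * retract_type :=
  let x := repr p.1 in let y := repr p.2 in
  (retract_pi (sigma x y), retract_pi (tau y x)).

End Solutions.

Record yb_pair := YBPair {
  yb_set : finType;
  yb_fun : yb_set * yb_set -> yb_set * yb_set
}.

Definition Ret (S : yb_pair) : yb_pair := YBPair (@retract_map _ (@yb_fun S)).

Definition has_mpl (X : finType) (r : X * X -> X * X) (m : nat) : Prop :=
  #|yb_set (iter m Ret (YBPair r))| = 1%N /\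
  forall k, (k < m)%N -> #|yb_set (iter k Ret (YBPair r))| <> 1%N.

Definition finite_mpl (X : finType) (r : X * X -> X * X) : Prop :=
  exists m, has_mpl r m.

Section RetractWellDefined.
Variables (X : finType) (r : X * X -> X * X).
Hypotheses (rYB : ybe_solution r) (rND : nondegenerate_solution r) (rI : involutive r).

Let sig_inj x : injective (sigma r x). Proof. exact: bij_inj (rND.1 x). Qed.

Let sig_tau x y : sigma r (sigma r x y) (tau r y x) = x.
Proof. by have := rI (x, y); rewrite /sigma /tau; case: (r (x, y)) => a b /= ->. Qed.

Let sigM x y z : sigma r (sigma r x y) (sigma r (tau r y x) z) =
  sigma r x (sigma r y z).
Proof. by have := rYB.2 (x, y, z) => /(congr1 (fun t => t.1.1)). Qed.

Let sigma_rel_inv x u v :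
  retract_rel r (sigma r x u) (sigma r x v) -> retract_rel r u v.
Proof.
move=> /retract_relP h; apply/retract_relP => z; apply: (@sig_inj x).
suff e : tau r u x = tau r v x by rewrite -(sigM x u z) -(sigM x v z) e h.
by apply: (@sig_inj (sigma r x u)); rewrite sig_tau h sig_tau.
Qed.

Let sigma_rel x u v :
  retract_rel r u v -> retract_rel r (sigma r x u) (sigma r x v).
Proof.
pose S := [set p : X * X | retract_rel r p.1 p.2].
pose g (p : X * X) := (sigma r x p.1, sigma r x p.2).
have gI : injective g by move=> [? ?] [? ?] [/sig_inj-> /sig_inj->].
have gS : g @^-1: S = S.
  apply/eqP; rewrite eqEcard card_preimset // leqnn andbT.
  by apply/subsetP=> p; rewrite !inE; apply: sigma_rel_inv.
move=> uv; have : (u, v) \in g @^-1: S by rewrite gS inE.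
by rewrite !inE.
Qed.

Lemma retract_rel_sigma x x' y y' : retract_rel r x x' -> retract_rel r y y' ->
  retract_rel r (sigma r x y) (sigma r x' y').
Proof. by move=> /retract_relP h ?; rewrite h; apply: sigma_rel. Qed.

Lemma retract_rel_tau x x' y y' : retract_rel r x x' -> retract_rel r y y' ->
  retract_rel r (tau r y x) (tau r y' x').
Proof.
move=> hx hy; have /retract_relP h := retract_rel_sigma hx hy.
move: hx hy => /retract_relP hx /retract_relP hy.
apply/retract_relP => z; apply: (@sig_inj (sigma r x y)).
by rewrite [RHS]h !sigM hx hy.
Qed.

Local Notation pi := (retract_pi r).
Let piP (a : retract_type r) : exists x, a = pi x.
Proof. by exists (repr a); rewrite /retract_pi reprK. Qed.

Lemma retract_mapE x y :
  retract_map (pi x, pi y) = (pi (sigma r x y), pi (tau r y x)).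
Proof.
have piE u v : retract_rel r u v -> pi u = pi v.
  by move/(@EquivQuot.eqmodP _ _ _ _ _ (defaultEncModRel (retract_equiv r))).
have rp z : retract_rel r (repr (pi z)) z.
  by apply/(@EquivQuot.eqmodP _ _ _ _ _ (defaultEncModRel (retract_equiv r)));
     apply: reprK.
rewrite /retract_map /=; congr (_, _); apply: piE.
  exact: retract_rel_sigma.
exact: retract_rel_tau.
Qed.

Let rmE x y : retract_map (pi x, pi y) = (pi (r (x, y)).1, pi (r (x, y)).2).
Proof. exact: retract_mapE. Qed.

Lemma retract_involutive : involutive (@retract_map X r).
Proof.
move=> [a b]; have [[x ->] [y ->]] := (piP a, piP b).
by rewrite rmE rmE -surjective_pairing rI.
Qed.

Let surj_bij (T : finType) (f : T -> T) : (forall y, exists x, y = f x) ->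
  bijective f.
Proof.
move=> fS; apply: injF_bij; apply/injectiveP/card_uniqP.
rewrite size_map -cardE; apply: eq_card => y.
by rewrite inE; have [x ->] := fS y; apply: codom_f.
Qed.

Lemma retract_nondegenerate : nondegenerate_solution (@retract_map X r).
Proof.
split=> a; apply: surj_bij => b; have [[x ->] [y ->]] := (piP a, piP b).
  have [g _ gK] := rND.1 x.
  by exists (pi (g y)); rewrite /sigma rmE /= -/(sigma r x (g y)) gK.
have [g _ gK] := rND.2 x.
by exists (pi (g y)); rewrite /tau rmE /= -/(tau r x (g y)) gK.
Qed.

Lemma retract_ybe_solution : ybe_solution (@retract_map X r).
Proof.
split; first exact: inv_bij retract_involutive.
move=> [[a b] c]; have [[x ->] [y ->] [z ->]] := And3 (piP a) (piP b) (piP c).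
pose pi3 (t : X * X * X) := (pi t.1.1, pi t.1.2, pi t.2).
have m12 t : map12 (@retract_map X r) (pi3 t) = pi3 (map12 r t).
  by case: t => [[u v] w]; rewrite /map12 rmE.
have m23 t : map23 (@retract_map X r) (pi3 t) = pi3 (map23 r t).
  by case: t => [[u v] w]; rewrite /map23 rmE.
by rewrite -[(_, _)]/(pi3 (x, y, z)) !(m12, m23) rYB.2.
Qed.

End RetractWellDefined.

Definition is_group (T : Type) (op : T -> T -> T) : Prop :=
  associative op /\
  exists e : T, [/\ left_id e op, right_id e op
    & forall a, exists b, op a b = e /\ op b a = e].

Section Braces.
Variables (A : finZmodType) (mul : A -> A -> A).

Definition circ (a b : A) : A := mul a b + a + b.

Definition left_brace : Prop :=
  (forall a b c, mul a (b + c) = mul a b + mul a c) /\ is_group circ.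

(* B is a left brace under the operations of A; the identity of circ is 0. *)
Definition sub_left_brace (B : {set A}) : Prop :=
  [/\ 0 \in B,
      forall a b, a \in B -> b \in B -> a - b \in B,
      forall a b, a \in B -> b \in B -> mul a b \in B
    & forall a, a \in B -> exists2 b, b \in B & circ a b = 0].

Definition generated_by (x : A) : Prop :=
  forall B : {set A}, sub_left_brace B -> x \in B -> B = [set: A].

(* The unique z with mul z u + z + u = 0, see [circ_invP]; the default value
   is irrelevant in a left brace. *)
Definition circ_inv (u : A) : A :=
  odflt 0 [pick z | mul z u + z + u == 0].

Definition brace_yb_map (p : A * A) : A * A :=
  let u := mul p.1 p.2 + p.2 in (u, mul (circ_inv u) p.1 + p.1).

Definition prod_set (C D : A -> Prop) : A -> Prop := fun a =>
  exists s : seq (A * A),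
    (forall p, p \in s -> C p.1 /\ D p.2) /\ a = \sum_(p <- s) mul p.1 p.2.

(* A^(m), for m >= 1; A^(1) = A. *)
Definition right_power (m : nat) : A -> Prop :=
  iter m.-1 (fun C => prod_set C (fun=> True)) (fun=> True).

Lemma circ_id : left_brace -> left_id 0 circ /\ right_id 0 circ.
Proof.
move=> [mulD [_ [e [e1 e2 _]]]].
have m0 a : mul a 0 = 0.
  by apply: (@addrI _ (mul a 0)); rewrite -mulD !addr0.
suff -> : 0 = e by [].
by have := e1 0; rewrite /circ m0 add0r addr0.
Qed.

Lemma circ_invP : left_brace ->
  forall u z, (mul z u + z + u == 0) = (z == circ_inv u).
Proof.
move=> hA; have [id0 id0'] := circ_id hA.
have [_ [cA [e [e1 e2 eV]]]] := hA.
have e0 : e = 0 by rewrite -(e1 0) id0'.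
have uniq u z z' : circ z u = 0 -> circ z' u = 0 -> z = z'.
  move=> h h'; have [v [uv _]] := eV u.
  by rewrite -(e2 z) -(e2 z') -uv !cA h h'.
move=> u z; rewrite /circ_inv; case: pickP => [w /eqP hw | no] /=.
  by apply/eqP/eqP => [hz | ->]; [apply: uniq hz hw | ].
by have [v [_ vu]] := eV u; have := no v; rewrite -/(circ v u) vu e0 eqxx.
Qed.

End Braces.

(* Main.v *)
From HB Require Import structures.
Require Import Defs.
From mathcomp Require Import all_boot all_algebra all_fingroup cyclic generic_quotient.
Import GRing.Theory.
Local Open Scope ring_scope.
Set Implicit Arguments.
Unset Strict Implicit.
Unset Printing Implicit Defensive.

(** Write [lam a b = mul a b + b]; in a left brace this is an action of the group
    [(A, circ)] on [(A, +)], and the Yang-Baxter map is [sigma a b = lam a b].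
    The proof rests on an explicit description of the iterated retraction: two
    points get identified after [k + 1] retractions exactly when their [sigma]
    maps agree up to identification after [k] retractions
    ([iter_retract_rel_retract]), so finite multipermutation level means that
    one of these relations is total ([finite_mplP]).

    From the brace to the solution. The right powers [A^(k)] are additive
    subgroups stable under [lam], and [a - b] in [A^(k)] forces
    [a c - b c] in [A^(k+1)] ([nil_power_addl]). So if [A^(m+1) = 0], downward
    induction shows that points whose difference lies in [A^(m+1-k)] are
    identified after [k] retractions; as [A^(1) = A], all are identified after
    [m].
    For indecomposability, the orbit of [x] under [lam] spans [A] additively,
    and [a + i w] is [a] composed with a [lam]-translate of [i w], which is again
    in [X]. Hence every [lam a] is a product of maps [sigma], and so preserves
    both blocks of a decomposition; but [X] is a single orbit.

    From the solution to the brace. On the permutations of [X], the maps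
    [f |-> f o sigma_(f^-1 y)] are bijective and commute (this is the
    Yang-Baxter equation), so they define an action of the free abelian
    group on [X]; by finiteness it factors through [A = (Z/N)^X]. Let [phi a] be
    the image of the identity under [a]. The action is equivariant for left
    multiplication, hence [phi (a + phi(a) b) = phi a o phi b], where
    permutations of [X] act on [A] by permuting coordinates. So
    [a b = phi(a) b - b] makes [A] a left brace, whose standard basis is a copy
    of [(X, r)]. If [X] is indecomposable, it is one orbit under the
    permutations [phi a]. If the level is finite, [A] is right nilpotent: the
    span of the [e_y - e_z] with [y], [z] identified after [k] retractions
    shrinks to 0 as [k] decreases, and multiplying it by [A] on the right
    decreases [k] ([retract_span_trivial], [trivial_mul]). Finally, right
    nilpotency together with additive generation by the orbit of [x] implies
    generation by [x]: a sub-brace containing [x] covers [A] modulo each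
    [A^(k)] in turn ([nil_generated_by]). *)

(** * Iterated retraction as a relation on the original set *)

(** The kernel of the projection of [X] onto its [k]-th retraction, expressed
    without quotients. *)
Fixpoint iter_retract_rel (X : finType) (r : X * X -> X * X) (k : nat) (y z : X)
    : Prop :=
  if k is k'.+1 then
    forall w, iter_retract_rel r k' (sigma r y w) (sigma r z w)
  else y = z.

Lemma iter_retract_rel_refl X r k y : @iter_retract_rel X r k y y.
Proof. by elim: k y => //= k IHk y w. Qed.

Lemma iter_retract_rel_trans X r k u v w : @iter_retract_rel X r k u v ->
  iter_retract_rel r k v w -> iter_retract_rel r k u w.
Proof.
elim: k u v w => [|k IHk] u v w /=; first by move=> ->.
by move=> uv vw t; apply: IHk (uv t) (vw t).
Qed.

Section IteratedRetraction.
Variables (X : finType) (r : X * X -> X * X).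
Hypotheses (r_ybe : ybe_solution r) (r_nd : nondegenerate_solution r)
  (r_inv : involutive r).

Lemma retract_piP y z : retract_pi r y = retract_pi r z <-> retract_rel r y z.
Proof.
split=> /(@EquivQuot.eqmodP _ _ _ _ _ (defaultEncModRel (retract_equiv r))) //.
Qed.

Lemma retract_pi_surj a : exists y, a = retract_pi r y.
Proof. by exists (repr a); rewrite /retract_pi reprK. Qed.

Lemma sigma_retract y z : sigma (@retract_map X r) (retract_pi r y)
  (retract_pi r z) = retract_pi r (sigma r y z).
Proof. by rewrite {1}/sigma retract_mapE. Qed.

(** The recursion peels off the last retraction, this lemma the first one; both
    agree because [sigma] descends to the quotient. *)
Lemma iter_retract_rel_retract k y z : iter_retract_rel r k.+1 y z <->
  iter_retract_rel (@retract_map X r) k (retract_pi r y) (retract_pi r z).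
Proof.
elim: k y z => [|k IHk] y z.
  by split=> [/retract_relP/retract_piP | /retract_piP/retract_relP].
split=> h w.
  have [v ->] := retract_pi_surj w.
  by rewrite !sigma_retract; apply/IHk/h.
by apply/IHk; rewrite -!sigma_retract; apply: h.
Qed.

End IteratedRetraction.

(** The recursion gives no direct induction on [k]: its hypothesis concerns [sigma y] and
    not [sigma (sigma w y)]. Passing to the retraction lowers [k] while keeping
    the form of the statement, down to equality. *)
Lemma iter_retract_rel_sigma (X : finType) (r : X * X -> X * X) :
  ybe_solution r -> nondegenerate_solution r -> involutive r ->
  forall k w y z, iter_retract_rel r k y z ->
    iter_retract_rel r k (sigma r w y) (sigma r w z).
Proof.
move=> + + + k; elim: k X r => [|k IHk] X r r_ybe r_nd r_inv w y z.
  by move=> ->.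
move=> /(iter_retract_rel_retract r_ybe r_nd r_inv) yz.
apply/(iter_retract_rel_retract r_ybe r_nd r_inv).
rewrite -!(sigma_retract r_ybe r_nd r_inv); apply: IHk yz.
- exact: retract_ybe_solution.
- exact: retract_nondegenerate.
- exact: retract_involutive.
Qed.

Lemma card_iter_Ret_le1 (X : finType) (r : X * X -> X * X) :
  ybe_solution r -> nondegenerate_solution r -> involutive r -> forall m,
  (#|yb_set (iter m Ret (YBPair r))| <= 1)%N <->
    (forall y z, iter_retract_rel r m y z).
Proof.
move=> + + + m; elim: m X r => [|m IHm] X r r_ybe r_nd r_inv.
  rewrite /=; split=> [/card_le1_eqP X1 y z | X1]; first exact: X1.
  by apply/card_le1_eqP=> y z _ _; apply: X1.
rewrite iterSr; apply: (iff_trans (IHm _ _ _ _ _)).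
- exact: retract_ybe_solution.
- exact: retract_nondegenerate.
- exact: retract_involutive.
split=> h a b; last first.
    have [y ->] := retract_pi_surj a; have [z ->] := retract_pi_surj b.
    exact/(iter_retract_rel_retract r_ybe r_nd r_inv).
by apply/(iter_retract_rel_retract r_ybe r_nd r_inv).
Qed.

Lemma finite_mplP (X : finType) (r : X * X -> X * X) (x : X) :
  ybe_solution r -> nondegenerate_solution r -> involutive r ->
  finite_mpl r <-> exists m, forall y z, iter_retract_rel r m y z.
Proof.
move=> r_ybe r_nd r_inv; have cardP := card_iter_Ret_le1 r_ybe r_nd r_inv.
have card_gt0 m : (0 < #|yb_set (iter m Ret (YBPair r))|)%N.
  elim: m => [|m /card_gt0P[y _]]; first by apply/card_gt0P; exists x.
  by apply/card_gt0P; exists (retract_pi _ y).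
split=> [[m [m1 _]] | [m /cardP m1]]; first by exists m; apply/cardP; rewrite m1.
have ex1 : exists n, #|yb_set (iter n Ret (YBPair r))| == 1%N.
  by exists m; rewrite eqn_leq m1 card_gt0.
exists (ex_minn ex1); case: ex_minnP => n /eqP n1 n_min; split=> // k lt_kn.
by move/eqP/n_min; rewrite leqNgt lt_kn.
Qed.

(** * Left braces *)

Definition brace_lam (A : finZmodType) (mul : A -> A -> A) (a b : A) : A :=
  mul a b + b.

Section LeftBrace.
Variables (A : finZmodType) (mul : A -> A -> A).
Hypothesis brA : left_brace mul.

Local Notation "a ∘ b" := (circ mul a b) (at level 40, left associativity).
Local Notation lam := (brace_lam mul).
Local Notation inv := (circ_inv mul).

Lemma brace_mulDr a b c : mul a (b + c) = mul a b + mul a c.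
Proof. exact: brA.1. Qed.

Lemma brace_mul0r a : mul a 0 = 0.
Proof. by apply: (@addrI _ (mul a 0)); rewrite -brace_mulDr !addr0. Qed.

Lemma brace_mulNr a b : mul a (- b) = - mul a b.
Proof. by apply/eqP; rewrite -addr_eq0 -brace_mulDr addNr brace_mul0r. Qed.

Lemma circ_lam a b : a ∘ b = a + lam a b.
Proof. by rewrite /circ /brace_lam [_ + a]addrC -addrA. Qed.

Lemma mul_lam a b : mul a b = lam a b - b.
Proof. by rewrite /brace_lam addrK. Qed.

Lemma circA a b c : a ∘ (b ∘ c) = a ∘ b ∘ c.
Proof. exact: brA.2.1. Qed.

Lemma circ0l a : 0 ∘ a = a.
Proof. exact: (circ_id brA).1. Qed.

Lemma circVl a : inv a ∘ a = 0.
Proof. by apply/eqP; rewrite /circ (circ_invP brA). Qed.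

Lemma circVr a : a ∘ inv a = 0.
Proof. by rewrite -[LHS]circ0l -(circVl (inv a)) -circA [_ ∘ (a ∘ _)]circA circVl
  circ0l. Qed.

Lemma lamD a b c : lam a (b + c) = lam a b + lam a c.
Proof. by rewrite /brace_lam brace_mulDr addrACA. Qed.

Lemma lamN a b : lam a (- b) = - lam a b.
Proof. by rewrite /brace_lam brace_mulNr opprD. Qed.

Lemma lamr0 a : lam a 0 = 0.
Proof. by rewrite /brace_lam brace_mul0r addr0. Qed.

Lemma lam0 b : lam 0 b = b.
Proof. by have := circ0l b; rewrite circ_lam add0r. Qed.

Lemma lam_circ a b c : lam (a ∘ b) c = lam a (lam b c).
Proof.
by have := circA a b c; rewrite !circ_lam lamD addrA => /addrI ->.
Qed.

Lemma lamK a : cancel (lam a) (lam (inv a)).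
Proof. by move=> b; rewrite -lam_circ circVl lam0. Qed.

Lemma lamVK a : cancel (lam (inv a)) (lam a).
Proof. by move=> b; rewrite -lam_circ circVr lam0. Qed.

Lemma add_circ a b : a + b = a ∘ lam (inv a) b.
Proof. by rewrite circ_lam lamVK. Qed.

(** The failure of right distributivity, controlled by writing the sum as a
    composite: [mul (a ∘ t) c = lam a (mul t c) + mul a c]. *)
Lemma mul_addl a b c : mul (a + b) c - mul a c = lam a (mul (lam (inv a) b) c).
Proof.
by rewrite !mul_lam (add_circ a b) lam_circ lamD lamN opprB addrA subrK.
Qed.

(** Shifted so that index 0 is the whole brace. *)
Definition nil_power (k : nat) : A -> Prop := right_power mul k.+1.

Lemma nil_power0 k : nil_power k 0.
Proof. by case: k => // k; exists [::]; rewrite big_nil. Qed.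

Lemma nil_powerD k a b : nil_power k a -> nil_power k b -> nil_power k (a + b).
Proof.
case: k => // k [s [sC ->]] [t [tC ->]]; exists (s ++ t).
by split=> [p|]; rewrite ?big_cat // mem_cat => /orP[/sC | /tC].
Qed.

Lemma nil_power_mul k a b : nil_power k a -> nil_power k.+1 (mul a b).
Proof.
by exists [:: (a, b)]; rewrite big_seq1; split=> // p; rewrite inE => /eqP ->.
Qed.

Lemma nil_powerS_ind (P : A -> Prop) k : P 0 ->
  (forall a b, P a -> P b -> P (a + b)) ->
  (forall a b, nil_power k a -> P (mul a b)) ->
  forall a, nil_power k.+1 a -> P a.
Proof.
move=> P0 PD PM _ [s [sC ->]]; elim: s sC => [|p s IHs] sC.
  by rewrite big_nil.
rewrite big_cons; apply: PD.
  by apply: PM; case: (sC p (mem_head _ _)).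
by apply: IHs => q qs; apply: sC; rewrite inE qs orbT.
Qed.

Lemma nil_power_decr k a : nil_power k.+1 a -> nil_power k a.
Proof.
elim: k a => // k IHk; apply: nil_powerS_ind; first exact: nil_power0.
  exact: nil_powerD.
by move=> a b /IHk; apply: nil_power_mul.
Qed.

(** [lam a (mul c w)] is the product of the [circ]-conjugate of [c] by [a] with
    [lam a w], and that conjugate is [lam a c + lam a (mul c (inv a))], whose
    second term lies one step deeper. So stability passes from [k] to [k + 1]. *)
Lemma nil_power_lam k a c : nil_power k c -> nil_power k (lam a c).
Proof.
elim: k c => // k IHk c; move: c; apply: nil_powerS_ind.
- by rewrite lamr0; apply: nil_power0.
- by move=> c d hc hd; rewrite lamD; apply: nil_powerD.
move=> c w hc.
have -> : lam a (mul c w) = mul (a ∘ c ∘ inv a) (lam a w).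
  by rewrite !mul_lam !lam_circ lamK lamD lamN.
apply: nil_power_mul.
have -> : a ∘ c ∘ inv a = lam a c + lam a (mul c (inv a)).
  rewrite -circA !circ_lam mul_lam lamD !lamD lamN addrCA.
  suff -> : lam a (inv a) = - a by rewrite opprK [a + _]addrC.
  by apply/eqP; rewrite -addr_eq0 addrC -circ_lam circVr.
by apply: nil_powerD; apply: IHk => //; apply/nil_power_decr/nil_power_mul.
Qed.

Lemma nil_power_addl k a b c : nil_power k b ->
  nil_power k.+1 (mul (a + b) c - mul a c).
Proof.
move=> hb; rewrite mul_addl; apply: nil_power_lam; apply: nil_power_mul.
exact: nil_power_lam.
Qed.

(** The additive span of an orbit is stable under [lam], hence under
    multiplication, hence is a sub-brace; by generation it is everything. *)
Lemma generated_by_span_ind x (P : A -> Prop) : generated_by mul x -> P 0 ->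
  (forall a c, P a -> P (a + lam c x)) -> forall a, P a.
Proof.
move=> genx P0 PS a; pose B : {set A} := <<[set lam c x | c : A]>>%g.
have lamB c b : b \in B -> lam c b \in B.
  move=> /gen_prodgP[n [f fX ->]].
  rewrite (big_morph (lam c) (@lamD c) (@lamr0 c)).
  elim/big_ind: _ => [|? ? ? ?|i _]; [exact: group1 | exact: groupM |].
  apply: mem_gen.
  by have /imsetP[d _ ->] := fX i; rewrite -lam_circ; apply: (imset_f (lam^~ x)).
have BD b c : b \in B -> c \in B -> b + c \in B by apply: groupM.
have BN b : b \in B -> - b \in B by rewrite -FinRing.zmodVgE groupV.
suff BT : B = [set: A].
  have : a \in B by rewrite BT.
  move=> /gen_prodgP[n [f fX ->]]; elim: n f fX => [|n IHn] f fX.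
    by rewrite big_ord0.
  rewrite big_ord_recr /=; have /imsetP[d _ ->] := fX ord_max.
  exact: PS (IHn _ _).
apply: genx.
  split=> [|b c bB cB|b c bB cB|b bB]; first exact: group1.
  - by rewrite BD ?BN.
  - by rewrite mul_lam BD ?BN ?lamB.
  exists (inv b); last exact: circVr.
  suff -> : inv b = - lam (inv b) b by rewrite BN ?lamB.
  by apply/eqP; rewrite -addr_eq0 -circ_lam circVl.
by rewrite mem_gen //; apply/imsetP; exists 0; rewrite ?lam0.
Qed.

(** A Nakayama-type argument. If [c = d + s] with [d] in the sub-brace and [s] in
    the [k]-th power, then [lam c x] and [lam d x] differ by
    [mul (d + s) x - mul d x], which lies in the next power. *)
Lemma nil_generated_by x k : (forall a, nil_power k a -> a = 0) ->
  (forall P : A -> Prop, P 0 -> (forall a c, P a -> P (a + lam c x)) ->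
     forall a, P a) ->
  generated_by mul x.
Proof.
move=> nilA span B [B0 BB BM BV] xB; apply/setP => a; rewrite inE.
have BD b c : b \in B -> c \in B -> b + c \in B.
  by move=> bB cB; rewrite -[c]opprK BB // -sub0r BB.
suff [b bB /nilA/eqP] : exists2 b, b \in B & nil_power k (a - b).
  by rewrite subr_eq0 => /eqP ->.
elim: k {nilA} a => [|k IHk] a; first by exists 0.
move: a; apply: span => [|a c [b bB ab]].
  by exists 0; rewrite ?subrr //; apply: nil_power0.
have [d dB cd] := IHk c; exists (b + lam d x).
  by rewrite BD // BD ?BM.
rewrite opprD addrACA; apply: nil_powerD ab _.
rewrite /brace_lam opprD addrACA subrr addr0.
by rewrite -[c in mul c _](subrKC d); apply: nil_power_addl.
Qed.

End LeftBrace.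

(** * From a nilpotent brace to a solution of finite level *)

Section BraceToSolution.
Variables (X : finType) (r : X * X -> X * X) (A : finZmodType)
  (mul : A -> A -> A) (i : X -> A) (x : X).
Hypotheses (brA : left_brace mul) (i_inj : injective i)
  (orbX : [set i y | y : X] = [set i x + mul a (i x) | a : A])
  (i_yb : forall y z : X,
     brace_yb_map mul (i y, i z) = (i (r (y, z)).1, i (r (y, z)).2)).

Local Notation lam := (brace_lam mul).
Local Notation "a ∘ b" := (circ mul a b) (at level 40, left associativity).
Local Notation inv := (circ_inv mul).

Lemma i_orbit y : exists a, i y = lam a (i x).
Proof.
have : i y \in [set i y | y : X] by rewrite imset_f.
by rewrite orbX => /imsetP[a _ ->]; exists a; rewrite /brace_lam addrC.
Qed.

Lemma lam_i a y : exists z, lam a (i y) = i z.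
Proof.
have [b ->] := i_orbit y; rewrite -lam_circ //.
have : i x + mul (a ∘ b) (i x) \in [set i y | y : X].
  by rewrite orbX; apply: (imset_f (fun a => i x + mul a (i x))).
by move=> /imsetP[z _ e]; exists z; rewrite -e /brace_lam addrC.
Qed.

Lemma i_sigma y z : i (sigma r y z) = lam (i y) (i z).
Proof. by have [] := i_yb y z. Qed.

Lemma nil_finite_mpl m : (forall a, nil_power mul m a -> a = 0) ->
  forall y z, iter_retract_rel r m y z.
Proof.
move=> nilA; suff H k y z :
    (k <= m)%N -> nil_power mul (m - k) (i y - i z) -> iter_retract_rel r k y z.
  by move=> y z; apply: H; rewrite // subnn.
elim: k y z => [|k IHk] y z le_km yz.
  apply/i_inj/eqP; rewrite -subr_eq0; apply/eqP/nilA.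
  by rewrite subn0 in yz.
move=> w; apply: IHk; first exact: ltnW.
rewrite !i_sigma /brace_lam opprD addrACA subrr addr0.
rewrite -[i y](subrKC (i z)) -subnSK //.
exact: nil_power_addl.
Qed.

(** All [lam a] preserve each block, by induction on a sum of orbit elements:
    [a + i w = a ∘ i v] with [i v = lam (inv a) (i w)], so that
    [lam (a + i w)] is [lam a] after [sigma v]. *)
Lemma generated_indecomposable : generated_by mul (i x) -> indecomposable r.
Proof.
move=> genx [D [D_neq0 dD covD rD]].
have [j xj] : exists j, x \in D j.
  have : x \in D true :|: D false by rewrite covD.
  by rewrite inE => /orP[]; [exists true | exists false].
have sigD v y : y \in D j -> sigma r v y \in D j.
  move=> yj; have [l vl] : exists l, v \in D l.
    have : v \in D true :|: D false by rewrite covD.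
    by rewrite inE => /orP[]; [exists true | exists false].
  have : r (v, y) \in setX (D j) (D l) by rewrite -rD imset_f // in_setX vl.
  by rewrite [r _]surjective_pairing in_setX => /andP[].
have lamDj a y : y \in D j -> exists2 z, z \in D j & lam a (i y) = i z.
  move: a y; apply: (generated_by_span_ind brA genx) => [y yj | a c IHa y yj].
    by exists y; rewrite ?lam0.
  have [w ->] := lam_i c x; rewrite (add_circ brA); have [v ->] := lam_i (inv a) w.
  rewrite lam_circ // -i_sigma; exact/IHa/sigD.
have DjT y : y \in D j.
  have [a iy] := i_orbit y; have [z zj iz] := lamDj a x xj.
  by have -> : y = z by apply: i_inj; rewrite iy.
have [y yNj] := set0Pn _ (D_neq0 (~~ j)).
have := disjointFr dD; case: j DjT yNj {xj sigD lamDj} => DjT yNj dF.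
  by have := dF y (DjT y); rewrite yNj.
by have := dF y yNj; rewrite DjT.
Qed.

End BraceToSolution.

(** * The brace of a solution *)

(** An alias of the function type, to carry the combined structure of a finite
    abelian group. *)
Definition zmod_vec (X : finType) (N : nat) := {ffun X -> 'Z_N}.
HB.instance Definition _ X N := GRing.Zmodule.on (zmod_vec X N).
HB.instance Definition _ X N := Finite.on (zmod_vec X N).

Section SolutionToBrace.
Variables (X : finType) (r : X * X -> X * X).
Hypotheses (r_ybe : ybe_solution r) (r_nd : nondegenerate_solution r)
  (r_inv : involutive r).

Definition sigma_perm (y : X) : {perm X} := perm (bij_inj (r_nd.1 y)).

Lemma sigma_permE y z : sigma_perm y z = sigma r y z.
Proof. exact: permE. Qed.

Lemma sigma_tau y z : sigma r (sigma r y z) (tau r z y) = y.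
Proof.
by have := r_inv (y, z); rewrite /sigma /tau; case: (r (y, z)) => a b /= ->.
Qed.

Lemma tauE y z : tau r z y = ((sigma_perm (sigma r y z))^-1 y)%g.
Proof.
by apply: (@perm_inj _ (sigma_perm (sigma r y z))); rewrite permKV sigma_permE
  sigma_tau.
Qed.

(** If [sigma u] maps [y] to [u], then [tau y] maps [u] to [y], by involutivity;
    as [tau y] is injective, [y] determines [u]. *)
Lemma diag_inj : injective (fun u => ((sigma_perm u)^-1 u)%g).
Proof.
move=> u v /=; set y := (X in X = _) => uv.
have tauy w : ((sigma_perm w)^-1 w)%g = y -> tau r y w = y.
  by move=> wy; have := tauE w y; rewrite -[sigma r w y]sigma_permE -{2}wy permKV wy.
by apply: (bij_inj (r_nd.2 y)); rewrite !tauy.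
Qed.

(** Products of permutations compose from left to right, so this is
    [f o sigma_(f^-1 y)]: if [f = phi a], it is [phi (a + e_y)]. *)
Definition step_fun (y : X) (f : {perm X}) : {perm X} :=
  (sigma_perm (f^-1 y) * f)%g.

Lemma step_fun_inj y : injective (step_fun y).
Proof.
move=> f g; rewrite /step_fun => fg.
have eqV : (f^-1 y = g^-1 y)%g.
  apply: diag_inj; move/(congr1 (fun h : {perm X} => (h^-1 y)%g)): fg.
  by rewrite !invMg !permM.
by move: fg; rewrite eqV => /mulgI.
Qed.

Definition step (y : X) : {perm {perm X}} := perm (@step_fun_inj y).

Lemma stepE y f : step y f = (sigma_perm (f^-1 y) * f)%g.
Proof. exact: permE. Qed.

(** The Yang-Baxter equation for [u] and [w], where [sigma u w = v], in a form
    symmetric in [u] and [v]; it is what makes the steps commute. *)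
Lemma sigma_perm_swap u v :
  (sigma_perm ((sigma_perm u)^-1 v) * sigma_perm u =
   sigma_perm ((sigma_perm v)^-1 u) * sigma_perm v)%g.
Proof.
apply/permP => z; rewrite !permM !sigma_permE.
pose w := ((sigma_perm u)^-1 v)%g.
have uw : sigma r u w = v by rewrite -sigma_permE permKV.
have := r_ybe.2 (u, w, z) => /(congr1 (fun t => t.1.1)).
rewrite -[LHS]/(sigma r (sigma r u w) (sigma r (tau r w u) z)).
rewrite -[RHS]/(sigma r u (sigma r w z)) tauE uw.
by move=> ->.
Qed.

Lemma step_comm y z : commute (step y) (step z).
Proof.
apply/permP => f; rewrite !permM !stepE !mulgA !invMg !permM.
by rewrite sigma_perm_swap.
Qed.

Lemma step_equivariant (g f : {perm X}) y :
  step (g y) (f * g)%g = (step y f * g)%g.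
Proof. by rewrite !stepE invMg permM permK mulgA. Qed.

(** The cardinal kills all powers of steps; the factor 2 keeps the modulus above
    1 when [X] is a singleton. *)
Definition modulus : nat := (2 * #|{perm {perm X}}|)%N.

Lemma modulus_gt1 : (1 < modulus)%N.
Proof. by apply: leq_pmulr; apply/card_gt0P; exists 1%g. Qed.

Lemma step_order y : (step y ^+ modulus)%g = 1%g.
Proof.
by rewrite /modulus mulnC expgM -cardsT expg_cardG ?in_setT ?expg1n.
Qed.

Local Notation A := (zmod_vec X modulus).
Implicit Types a b c : A.

Definition basis (y : X) : A := [ffun z => (z == y)%:R].

(** Since coordinates are residues, positive multiples of basis vectors suffice
    and no subtraction case is needed. *)
Lemma basis_ind (P : A -> Prop) : P 0 -> (forall a y, P a -> P (a + basis y)) ->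
  forall a, P a.
Proof.
move=> P0 PS a.
have -> : a = \sum_y basis y *+ a y.
  apply/ffunP => z; rewrite sum_ffunE (bigD1 z) //= big1 ?addr0 => [|y yz].
    by rewrite ffunMnE ffunE eqxx natr_Zp.
  by rewrite ffunMnE ffunE eq_sym (negbTE yz) mul0rn.
elim/big_rec: _ => // y b _ Pb; rewrite addrC; elim: (nat_of_ord _) => [|n IHn].
  by rewrite mulr0n addr0.
by rewrite mulrSr addrA; apply: PS.
Qed.

Lemma basis_inj : injective basis.
Proof.
move=> y z /ffunP/(_ y); rewrite !ffunE eqxx; by case: eqP.
Qed.

Definition act a : {perm {perm X}} := (\prod_z step z ^+ a z)%g.

Lemma act_basis y : act (basis y) = step y.
Proof.
rewrite /act (eq_bigr (fun z => if z == y then step z else 1%g)) => [|z _].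
  by rewrite -big_mkcond big_pred1_eq.
rewrite ffunE; case: eqP => _ /=; last by rewrite expg0.
by rewrite /= !Zp_cast ?modulus_gt1 // modn_small ?modulus_gt1.
Qed.

Lemma act0 : act 0 = 1%g.
Proof. by rewrite /act big1 // => z _; rewrite ffunE expg0. Qed.

(** Coordinates add modulo [modulus], which the order of the steps absorbs; the
    product is split by commutation since the group is not abelian. *)
Lemma actD a b : act (a + b) = (act a * act b)%g.
Proof.
rewrite /act; elim: (index_enum X) => [|z s IHs]; first by rewrite !big_nil mulg1.
rewrite !big_cons {}IHs ffunE /=.
rewrite expg_mod ?Zp_cast ?modulus_gt1 ?step_order // expgD -!mulgA.
congr (_ * _)%g; rewrite !mulgA; congr (_ * _)%g.
elim/big_ind: _ => [|f g fz gz|y _]; first exact: commute1.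
  exact: commuteM.
by apply/commuteX2/step_comm.
Qed.

Definition phi a : {perm X} := act a 1%g.

Lemma phi0 : phi 0 = 1%g.
Proof. by rewrite /phi act0 perm1. Qed.

Lemma phiDbasis a y : phi (a + basis y) = (sigma_perm ((phi a)^-1 y) * phi a)%g.
Proof. by rewrite /phi actD act_basis permM stepE. Qed.

Lemma phi_basis y : phi (basis y) = sigma_perm y.
Proof. by rewrite -[basis y]add0r phiDbasis phi0 invg1 perm1 mulg1. Qed.

Definition permute (g : {perm X}) a : A := [ffun z => a (g^-1 z)%g].

Lemma permuteD g a b : permute g (a + b) = permute g a + permute g b.
Proof. by apply/ffunP => z; rewrite !ffunE. Qed.

Lemma permute0 g : permute g 0 = 0.
Proof. by apply/ffunP => z; rewrite !ffunE. Qed.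

Lemma permuteN g a : permute g (- a) = - permute g a.
Proof. by apply/ffunP => z; rewrite !ffunE. Qed.

Lemma permute1 a : permute 1 a = a.
Proof. by apply/ffunP => z; rewrite ffunE invg1 perm1. Qed.

Lemma permuteM (f g : {perm X}) a : permute (f * g) a = permute g (permute f a).
Proof. by apply/ffunP => z; rewrite !ffunE invMg permM. Qed.

Lemma permute_basis g y : permute g (basis y) = basis (g y).
Proof.
apply/ffunP => z; rewrite !ffunE; congr (nat_of_bool _)%:R.
by apply/eqP/eqP => [<-|->]; rewrite ?permK ?permKV.
Qed.

Lemma act_equivariant (f g : {perm X}) b :
  act (permute g b) (f * g)%g = (act b f * g)%g.
Proof.
move: b f; apply: basis_ind => [|b y IHb] f.
  by rewrite permute0 act0 !perm1.
rewrite permuteD permute_basis !actD !permM IHb !act_basis.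
exact: step_equivariant.
Qed.

(** The brace structure comes from this identity, which says that [phi] is a
    homomorphism for the operation [a + phi(a) b]. *)
Lemma phi_circ a b : phi (a + permute (phi a) b) = (phi b * phi a)%g.
Proof. by rewrite /phi actD permM -/(phi a) -act_equivariant mul1g. Qed.

Lemma phiV a : phi (- permute (phi a)^-1 a) = (phi a)^-1%g.
Proof.
apply/eqP; rewrite -mulg_eq1 -phi_circ.
by rewrite permuteN -permuteM mulVg permute1 subrr phi0.
Qed.

Definition vec_mul a b : A := permute (phi a) b - b.

Lemma vec_lam a b : brace_lam vec_mul a b = permute (phi a) b.
Proof. by rewrite /brace_lam subrK. Qed.

Lemma vec_circ a b : circ vec_mul a b = a + permute (phi a) b.
Proof. by rewrite /circ /vec_mul addrAC subrK addrC. Qed.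

Lemma vec_left_brace : left_brace vec_mul.
Proof.
split=> [a b c|]; first by rewrite /vec_mul permuteD opprD addrACA.
split=> [a b c|]; first by rewrite !vec_circ permuteD phi_circ permuteM addrA.
exists 0; split=> [a|a|a].
- by rewrite vec_circ phi0 permute1 add0r.
- by rewrite vec_circ permute0 addr0.
exists (- permute (phi a)^-1 a); rewrite !vec_circ.
by rewrite phiV addNr permuteN -permuteM mulVg permute1 subrr.
Qed.

Lemma basis_yb y z : brace_yb_map vec_mul (basis y, basis z) =
  (basis (r (y, z)).1, basis (r (y, z)).2).
Proof.
pose u := brace_lam vec_mul (basis y) (basis z).
rewrite -[LHS]/(u, brace_lam vec_mul (circ_inv vec_mul u) (basis y)).
have -> : u = basis (sigma r y z).
  by rewrite /u vec_lam phi_basis permute_basis sigma_permE.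
congr (_, _).
apply: (can_inj (lamK vec_left_brace (basis (sigma r y z)))).
rewrite lamVK; last exact: vec_left_brace.
rewrite vec_lam phi_basis permute_basis sigma_permE.
by rewrite sigma_tau.
Qed.

(** The orbit is stable under all [sigma u], and then under all [tau v] because
    [sigma (sigma u v)] maps [tau v u] to [u]; if it were proper, it and its
    complement would decompose [X]. *)
Lemma basis_orbit x : indecomposable r -> forall y, exists a, y = phi a x.
Proof.
move=> indec y; pose O := [set phi a x | a : A].
have sigO u v : v \in O -> sigma r u v \in O.
  move=> /imsetP[a _ ->]; apply/imsetP.
  exists (basis u + permute (phi (basis u)) a) => //.
  by rewrite phi_circ permM phi_basis sigma_permE.
have sigON u v : (sigma r u v \in O) = (v \in O).
  apply/idP/idP; last exact: sigO.
  pose S := sigma_perm u @^-1: O; have OS : O = S.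
    apply/eqP; rewrite eqEcard card_preimset ?leqnn ?andbT; last exact: perm_inj.
    by apply/subsetP=> w wO; rewrite inE sigma_permE sigO.
  by move=> uvO; rewrite OS inE sigma_permE.
have tauO u v : (tau r v u \in O) = (u \in O).
  by rewrite -(sigON (sigma r u v)) sigma_tau.
have [yO | yNO] := boolP (y \in O); first by have /imsetP[a _ ->] := yO; exists a.
case: indec; exists (fun j => if j then O else ~: O); split.
- move=> [] /=; apply/set0Pn; last by exists y; rewrite inE.
  by exists x; apply/imsetP; exists 0; rewrite ?phi0 ?perm1.
- by rewrite -setI_eq0 setICr.
- by rewrite setUCr.
move=> j l; pose D j := if j then O else ~: O.
have rD k n p : p \in setX (D k) (D n) -> r p \in setX (D n) (D k).
  case: p => u v; rewrite [r _]surjective_pairing !in_setX /= => /andP[uk vn].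
  by move: k n uk vn => [] [] /=; rewrite ?inE -/(sigma r u v) -/(tau r v u) sigON
    tauO => -> ->.
apply/setP=> p; apply/imsetP/idP => [[q qD ->] | pD]; first exact: rD.
by exists (r p); rewrite ?r_inv //; apply: rD.
Qed.

Lemma phi_iter_retract k a y z : iter_retract_rel r k y z ->
  iter_retract_rel r k (phi a y) (phi a z).
Proof.
move: a y z; apply: basis_ind => [|a u IHa] y z yz; first by rewrite phi0 !perm1.
rewrite phiDbasis !permM !sigma_permE; apply: IHa.
exact: iter_retract_rel_sigma.
Qed.

(** The additive subgroup generated by the differences [e_y - e_z] of identified
    points; closure under opposite follows from finiteness. *)
Inductive retract_span (k : nat) : A -> Prop :=
| RetractSpan0 : retract_span k 0
| RetractSpanS c y z : retract_span k c -> iter_retract_rel r k y z ->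
    retract_span k (c + (basis y - basis z)).

Lemma retract_spanD k c d : retract_span k c -> retract_span k d ->
  retract_span k (c + d).
Proof.
move=> hc; elim=> [|d' y z _ IHd yz]; first by rewrite addr0.
by rewrite addrA; apply: RetractSpanS.
Qed.

Definition phi_trivial k c := forall a w,
  iter_retract_rel r k (phi (c + a) w) (phi a w).

(** Adding [e_y - e_z] changes [phi a] only by replacing a factor [sigma z'] by
    [sigma y'], where [y'], [z'] are images of [y], [z] under the same
    permutation. As these are still identified at level [k + 1], the two factors
    agree at level [k]. *)
Lemma retract_span_trivial k c : retract_span k.+1 c -> phi_trivial k c.
Proof.
elim=> [|{}c y z _ IHc yz] a w; first by rewrite add0r; apply: iter_retract_rel_refl.
rewrite -addrA; apply: iter_retract_rel_trans (IHc _ _) _.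
rewrite addrAC -addrA.
move: (a - basis z) (subrK (basis z) a) => b <-.
rewrite addrC !phiDbasis !permM !sigma_permE; apply: phi_iter_retract.
by rewrite -phiV; apply: (phi_iter_retract (k := k.+1)).
Qed.

Lemma trivial_mul k c d : phi_trivial k c -> retract_span k (vec_mul c d).
Proof.
move=> hc; move: d; apply: basis_ind => [|d y IHd].
  by rewrite brace_mul0r; [constructor | exact: vec_left_brace].
rewrite brace_mulDr; last exact: vec_left_brace.
apply: retract_spanD IHd _; rewrite /vec_mul permute_basis -[_ - _]add0r.
by constructor; [constructor |]; have := hc 0 y; rewrite addr0 phi0 perm1.
Qed.

(** The bound starts with the square of [A], as every [phi d] acts trivially at a
    level where all points are identified. *)
Lemma nil_power_retract_span m : (forall y z, iter_retract_rel r m y z) ->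
  forall k c, (k <= m)%N -> nil_power vec_mul k.+1 c -> retract_span (m - k) c.
Proof.
move=> total; elim=> [|k IHk] c le_km;
  (apply: nil_powerS_ind; [exact: RetractSpan0 | exact: retract_spanD |]) => a b.
  by move=> _; rewrite subn0; apply: trivial_mul => d w.
move=> /(IHk _ (ltnW le_km)); rewrite -subnSK // => /retract_span_trivial.
exact: trivial_mul.
Qed.

Lemma nil_vec m : (forall y z, iter_retract_rel r m y z) ->
  forall c, nil_power vec_mul m.+1 c -> c = 0.
Proof.
move=> total c /(nil_power_retract_span total (leqnn m)); rewrite subnn.
by elim=> // d y z _ -> /= ->; rewrite subrr addr0.
Qed.

End SolutionToBrace.

Theorem theorem35 (X : finType) (r : X * X -> X * X)
    (r_solution : ybe_solution r) (r_nondegenerate : nondegenerate_solution r)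
    (r_involutive : involutive r) (x : X) :
  (indecomposable r /\ finite_mpl r)
  <->
  (exists (A : finZmodType) (mul : A -> A -> A) (i : X -> A),
    left_brace mul /\
    injective i /\
    generated_by mul (i x) /\
    [set i y | y : X] = [set i x + mul a (i x) | a : A] /\
    (forall y z : X,
       brace_yb_map mul (i y, i z) = (i (r (y, z)).1, i (r (y, z)).2)) /\
    (exists m : nat, (0 < m)%N /\
       forall a : A, right_power mul m a <-> a = 0)).
Proof.
split=> [[indec /(finite_mplP x r_solution r_nondegenerate r_involutive)[m total]]
        | [A [mul [i [brA [i_inj [genx [orbX [i_yb [m [m_gt0 nilA]]]]]]]]]]].
  pose A := zmod_vec X (modulus X); pose e y : A := basis y.
  pose mul : A -> A -> A := vec_mul r_nondegenerate r_involutive.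
  have brA : left_brace mul by apply: vec_left_brace.
  have nilA c : nil_power mul m.+1 c -> c = 0 by apply: nil_vec total c.
  have orb := basis_orbit r_solution r_nondegenerate r_involutive x indec.
  have lam_e a y : brace_lam mul a (e y) = e (phi r_nondegenerate r_involutive a y).
    by rewrite vec_lam permute_basis.
  exists A, mul, e; split=> //; split; first exact: basis_inj.
  split.
    apply: (nil_generated_by brA nilA) => P P0 PS; apply: basis_ind => // a y Pa.
    by have [b ->] := orb y; have := PS a b Pa; rewrite lam_e.
  split.
    apply/setP => a; apply/imsetP/imsetP => [[y _ ->] | [b _ ->]].
      by have [b ->] := orb y; exists b; rewrite // -lam_e addrC.
    by exists (phi r_nondegenerate r_involutive b x); rewrite // -lam_e addrC.
  split; first exact: basis_yb.
  exists m.+2; split=> // a; split=> [|->]; first exact: nilA.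
  exact: (nil_power0 mul m.+1).
case: m m_gt0 nilA => // m _ nilA; split.
  exact: generated_indecomposable brA i_inj orbX i_yb genx.
apply/(finite_mplP x r_solution r_nondegenerate r_involutive); exists m.
apply: (nil_finite_mpl brA i_inj i_yb) => a; apply: (nilA a).1.
Qed.
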